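(* Let $\ell, k$ be integers with $2 \le \ell \le k$, and let $\alpha_\ell^k = ( *, \dots, *, 1, *, \dots, * ) \in (\mathbb{F}_2 \cup \{*\})^k$ be the vector whose $\ell$-th coordinate is $1$ and whose other $k-1$ coordinates are all $*$. Then the sequence $\bigl(g_{\alpha_\ell^k}(n)\bigr)_{n \ge 1}$ is bounded if and only if $\ell$ is a power of $2$.
   Context: Write $[n] = \{1, \dots, n\}$ and let $2^{[n]}$ be its power set. For $\alpha = (\alpha_1, \dots, \alpha_k) \in (\mathbb{F}_2 \cup \{*\})^k$, a set family $\mathcal{F}$ is an $\alpha$-ville if for each $i = 1, \dots, k$ with $\alpha_i \in \mathbb{F}_2$, the congruence \[ |F_1 \cap \dots \cap F_i| + |F_1 \cup \dots \cup F_i| \equiv \alpha_i \pmod 2 \] holds for any $i$ distinct members $F_1, \dots, F_i \in \mathcal{F}$; a coordinate $\alpha_i = *$ imposes no restriction. Let $g_\alpha(n)$ be the maximum of $|\mathcal{F}|$ over all $\alpha$-villes $\mathcal{F} \subseteq 2^{[n]}$. *)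

(* Defs.v *)
From mathcomp Require Import all_boot all_order all_algebra.

Set Implicit Arguments.
Unset Strict Implicit.
Unset Printing Implicit Defensive.

Import GRing.Theory.

(* In [alpha : k.-tuple (option 'F_2)], [None] stands for the symbol "*".
   Indices are shifted by one: [tnth alpha i] is the coordinate of index
   [i.+1] and so constrains the subfamilies of [i.+1] distinct members.
   These are nonempty, so the convention for an empty intersection plays
   no role.  The ground set {1, ..., n} is modelled by ['I_n]. *)
Definition ville (k n : nat) (alpha : k.-tuple (option 'F_2))
    (F : {set {set 'I_n}}) : bool :=
  [forall i : 'I_k,
    if tnth alpha i is Some a then
      [forall S : {set {set 'I_n}},
        (S \subset F) && (#|S| == i.+1) ==>
        ((#|\bigcap_(A in S) A| + #|\bigcup_(A in S) A|)%N%:R == a)%R]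
    else true].

(* [ville alpha set0] holds for every [alpha], so this is the maximum over a
   nonempty finite collection. *)
Definition g (k : nat) (alpha : k.-tuple (option 'F_2)) (n : nat) : nat :=
  \max_(F : {set {set 'I_n}} | ville alpha F) #|F|.

Definition alpha_at (l k : nat) : k.-tuple (option 'F_2) :=
  [tuple if i.+1 == l then Some 1%R else None | i < k].

(* Main.v *)
(* A point x contributes an odd amount to |F_1 n ... n F_l| + |F_1 u ... u F_l|
   exactly when it splits {F_1, ..., F_l}, i.e. lies in some but not all F_i.
   If l = 2^m and E consists of 2l - 1 members, each point splits an even number
   of the l-subsets of E, because 'C(t, l) is odd for exactly one of t = u and
   t = 2l - 1 - u.  But 'C(2l - 1, l) is odd, so E is not a ville.
   If l = 2^a q with q > 1 odd, let the points be all 2^a-subsets of [N] and the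
   members be the stars of the elements of [N].  No point contains l elements of
   [N], so l stars are split by 'C(N, 2^a) - 'C(N - l, 2^a) points, and this is
   odd by Lucas. *)

Require Import Defs.
From mathcomp Require Import all_boot all_order all_algebra.
From mathcomp Require Import zify.

(** Since [i * 'C(2 ^ m, i)] is a multiple of [2 ^ m], an odd binomial would force [2 ^ m] to divide
    the smaller positive number [i]. *)
Lemma odd_bin_pow2 (m i : nat) : 0 < i < 2 ^ m -> odd 'C(2 ^ m, i) = false.
Proof.
case/andP=> i_gt0 lt_i; apply/negbTE/negP => odd_bin.
have : 2 ^ m %| i * 'C(2 ^ m, i).
  case: i i_gt0 {lt_i odd_bin} => // i _.
  by rewrite -mul_bin_diag dvdn_mulr.
rewrite Gauss_dvdl ?coprimeXl ?coprime2n // => /(dvdn_leq i_gt0).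
by rewrite leqNgt lt_i.
Qed.

(** The case of Lucas' theorem that all parity counts rest on. Both sides flip when [n] grows by
    [2 ^ m]: splitting off [2 ^ m] elements by Vandermonde, only the two extreme terms survive mod
    2, and one of them is 1. *)
Lemma odd_bin_divn (m n : nat) : odd 'C(n, 2 ^ m) = odd (n %/ 2 ^ m).
Proof.
have pow_gt0 : 0 < 2 ^ m by rewrite expn_gt0.
elim/ltn_ind: n => n IHn.
have [lt_n|le_n] := ltnP n (2 ^ m); first by rewrite bin_small // divn_small.
rewrite -(subnKC le_n) divnDl // divnn pow_gt0 add1n /= -IHn; last by lia.
rewrite -binomial.Vandermonde.
have {IHn le_n} := odd_bin_pow2 m; case: (2 ^ m) pow_gt0 => // p _ even_bin.
rewrite big_ord_recl big_ord_recr /= bin0 subn0 mul1n binn /bump subnn bin0.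
rewrite oddD oddD (big_morph odd oddD (erefl _)) big1 ?addbT // => i _.
by rewrite oddM even_bin //= ltnS ltn_ord.
Qed.

Lemma ville_alpha_atP (l k n : nat) (F : {set {set 'I_n}}) :
  0 < l <= k ->
  reflect (forall S : {set {set 'I_n}}, S \subset F -> #|S| = l ->
             odd (#|\bigcap_(A in S) A| + #|\bigcup_(A in S) A|))
          (ville (alpha_at l k) F).
Proof.
case/andP=> l_gt0 le_lk.
have natr_F2 (c : nat) : (c%:R == 1 :> 'F_2)%R = odd c.
  by rewrite -val_eqE /= val_Fp_nat // modn2; case: (odd c).
apply: (iffP forallP) => [vF S sSF cS | oddF i].
  have lt_lk : l.-1 < k by rewrite prednK.
  have := vF (Ordinal lt_lk); rewrite tnth_mktuple /= prednK // eqxx.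
  by move/forallP/(_ S); rewrite sSF cS eqxx natr_F2.
rewrite tnth_mktuple; case: eqP => // eq_il.
apply/forallP => S; apply/implyP => /andP[sSF /eqP cS].
by rewrite natr_F2 oddF // cS.
Qed.

Lemma villeS (k n : nat) (alpha : k.-tuple (option 'F_2))
    (E F : {set {set 'I_n}}) :
  E \subset F -> ville alpha F -> ville alpha E.
Proof.
move=> sEF /forallP vF; apply/forallP => i; move: (vF i).
case: (tnth alpha i) => // a /forallP vFi.
apply/forallP => S; apply/implyP => /andP[sSE cS].
by move/implyP: (vFi S); apply; rewrite (subset_trans sSE sEF).
Qed.

Lemma leq_card_g (k n : nat) (alpha : k.-tuple (option 'F_2))
    (F : {set {set 'I_n}}) :
  ville alpha F -> #|F| <= g alpha n.
Proof. by move=> vF; rewrite /g (bigmax_sup F). Qed.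

Lemma exists_subset_card (T : finType) (A : {set T}) (c : nat) :
  c <= #|A| -> exists2 B : {set T}, B \subset A & #|B| = c.
Proof.
rewrite -bin_gt0 -cards_draws card_gt0 => /set0Pn[B].
by rewrite inE => /andP[sBA /eqP cB]; exists B.
Qed.

(** Written point by point, like the union below, so that a sum over subfamilies can be exchanged
    with the sum over points. *)
Lemma card_bigcap_sum (T : finType) (S : {set {set T}}) :
  #|\bigcap_(A in S) A| = \sum_x (S \subset [set A : {set T} | x \in A]).
Proof.
rewrite -sum1_card big_mkcond; apply: eq_bigr => x _.
have -> : (x \in \bigcap_(A in S) A) = (S \subset [set A : {set T} | x \in A]).
  apply/bigcapP/subsetP => sub A AS; first by rewrite inE sub.
  by have := sub A AS; rewrite inE.
by case: (_ \subset _).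
Qed.

Lemma card_bigcup_sum (T : finType) (S : {set {set T}}) :
  #|\bigcup_(A in S) A| = \sum_x ~~ (S \subset [set A : {set T} | x \notin A]).
Proof.
rewrite -sum1_card big_mkcond; apply: eq_bigr => x _.
have -> : (x \in \bigcup_(A in S) A) =
          ~~ (S \subset [set A : {set T} | x \notin A]).
  apply/bigcupP/subsetPn => -[A AS xA]; exists A => //.
    by rewrite inE negbK.
  by move: xA; rewrite inE negbK.
by case: (_ \subset _).
Qed.

Lemma sum_draws_subset (T : finType) (E P : {set T}) (l : nat) :
  \sum_(S : {set T} | (S \subset E) && (#|S| == l)) (S \subset P)
    = 'C(#|E :&: P|, l).
Proof.
rewrite -cards_draws -sum1_card [LHS]big_mkcond [RHS]big_mkcond.
apply: eq_bigr => S _; rewrite inE subsetI.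
by case: (S \subset E); case: (S \subset P); case: (_ == l).
Qed.

Lemma card_ville_pow2 (m k n : nat) (F : {set {set 'I_n}}) :
  2 ^ m <= k -> ville (alpha_at (2 ^ m) k) F -> #|F| < (2 ^ m).*2.-1.
Proof.
move=> le_k vF; rewrite ltnNge; apply/negP => leF.
have l_gt0 : 0 < 2 ^ m by rewrite expn_gt0.
have [E sEF cE] := exists_subset_card _ _ _ leF.
have /ville_alpha_atP := villeS _ _ _ _ _ sEF vF.
rewrite l_gt0 => /(_ le_k) vE.
pose draws (S : {set {set 'I_n}}) := (S \subset E) && (#|S| == 2 ^ m).
have odd_draws : odd 'C(#|E|, 2 ^ m).
  rewrite odd_bin_divn cE.
  have -> : (2 ^ m).*2.-1 = 1 * 2 ^ m + (2 ^ m).-1 by lia.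
  by rewrite divnMDl // divn_small ?addn0 // prednK.
have sum1_draws : \sum_(S | draws S) 1 = 'C(#|E|, 2 ^ m).
  by rewrite -cards_draws -sum1_card; apply: eq_bigl => S; rewrite inE.
(* An odd number of terms, each odd; counting the same sum by points will make it even. *)
have : odd (\sum_(S | draws S) (#|\bigcap_(A in S) A| + #|\bigcup_(A in S) A|)).
  rewrite (big_morph odd oddD (erefl _)) (eq_bigr (fun => odd 1)).
    by rewrite -(big_morph odd oddD (erefl _)) sum1_draws.
  by move=> S /andP[sSE /eqP cS]; rewrite vE.
under eq_bigr do rewrite card_bigcap_sum card_bigcup_sum -big_split.
rewrite exchange_big /= (big_morph odd oddD (erefl _)) big1 // => x _.
(* If [u] members of [E] contain [x] and [v] miss it, then [x] contributes ['C(u, 2 ^ m)] through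
   intersections and ['C(#|E|, 2 ^ m) - 'C(v, 2 ^ m)] through unions. *)
rewrite big_split /= sum_draws_subset oddD.
set P := [set A : {set 'I_n} | x \in A].
set Q := [set A : {set 'I_n} | x \notin A].
have sum_notQ : \sum_(S | draws S) ~~ (S \subset Q) + 'C(#|E :&: Q|, 2 ^ m)
    = 'C(#|E|, 2 ^ m).
  rewrite -sum_draws_subset -big_split -sum1_draws; apply: eq_bigr => S _.
  by case: (S \subset Q).
have cEPQ : #|E :&: P| + #|E :&: Q| = (2 ^ m).*2.-1.
  rewrite -cE -(cardsID P E); congr (_ + #|pred_of_set _|).
  by apply/setP => A; rewrite !inE andbC.
have := congr1 odd sum_notQ; rewrite oddD odd_draws !odd_bin_divn.
(* The two counts add up to [(2 ^ m).*2.-1], so exactly one of them reaches [2 ^ m]; its quotient by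
   [2 ^ m] is 1 and the other's is 0. *)
have [lt_P|le_P] := ltnP #|E :&: P| (2 ^ m).
  have -> : #|E :&: Q| = 1 * 2 ^ m + (#|E :&: Q| - 2 ^ m) by lia.
  rewrite divnMDl // !divn_small ?addn0; lia.
have -> : #|E :&: P| = 1 * 2 ^ m + (#|E :&: P| - 2 ^ m) by lia.
rewrite divnMDl // !divn_small ?addn0; lia.
Qed.

Section Stars.

Variables N j : nat.

Let points := [set T : {set 'I_N} | #|T| == j].

(** A ville lives on an ordinal type, so [enum_val] numbers the [j]-subsets that serve as points. *)
Definition star (p : 'I_N) : {set 'I_#|points|} :=
  [set i : 'I_#|points| | p \in (enum_val i : {set 'I_N})].

Lemma card_points : #|points| = 'C(N, j).
Proof. by rewrite card_draws card_ord. Qed.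

Lemma star_inj : 0 < j < N -> injective star.
Proof.
case/andP=> j_gt0 lt_jN p q eq_pq; apply/eqP/negPn/negP => neq_pq.
(* Adding [p] to [B] gives a [j]-subset that contains [p] but not [q], a point separating the two
   stars. *)
have /exists_subset_card[B sB cB] : j.-1 <= #|~: [set p; q]|.
  by have := cardsC [set p; q]; rewrite cards2 neq_pq card_ord; lia.
have [pB qB] : p \notin B /\ q \notin B.
  by split; apply/negP => /(subsetP sB); rewrite !inE eqxx ?orbT.
have TP : p |: B \in points by rewrite inE cardsU1 pB cB; lia.
have := congr1 (fun A : {set _} => enum_rank_in TP (p |: B) \in A) eq_pq.
rewrite !inE enum_rankK_in // !inE eqxx (eq_sym q).
by rewrite (negbTE neq_pq) (negbTE qB).
Qed.

Lemma card_bigcap_star (P : {set 'I_N}) :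
  j < #|P| -> #|\bigcap_(p in P) star p| = 0.
Proof.
move=> lt_jP; apply/eqP; rewrite cards_eq0; apply/eqP/setP => i.
rewrite in_set0; apply/negbTE/negP => /bigcapP iP.
have /subset_leq_card : P \subset enum_val i.
  by apply/subsetP => p /iP; rewrite inE.
by have := enum_valP i; rewrite inE; lia.
Qed.

(** The points outside the union are the [j]-subsets of the complement of [P]. *)
Lemma card_bigcup_star (P : {set 'I_N}) :
  #|\bigcup_(p in P) star p| + 'C(N - #|P|, j) = 'C(N, j).
Proof.
rewrite -card_points.
have -> : N - #|P| = #|~: P| by have := cardsC P; rewrite card_ord; lia.
rewrite -[RHS]card_ord -(cardsC (\bigcup_(p in P) star p)); congr (_ + _).
rewrite -cards_draws -(card_imset _ enum_val_inj); apply: eq_card => T.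
apply/idP/imsetP => [|[i iP ->]].
  rewrite inE => /andP[sTP cT].
  have TP : T \in points by rewrite inE.
  exists (enum_rank_in TP T); last by rewrite enum_rankK_in.
  rewrite inE; apply/negP => /bigcupP[p pP].
  rewrite inE enum_rankK_in // => /(subsetP sTP).
  by rewrite inE pP.
have := enum_valP i; rewrite !inE => ->; rewrite andbT.
apply/subsetP => p pi; rewrite inE; apply/negP => pP.
by move: iP; rewrite inE => /negP[]; apply/bigcupP; exists p; rewrite ?inE.
Qed.

End Stars.

Lemma ville_star (a q k N : nat) :
  odd q -> 1 < q -> 2 ^ a * q <= k -> 2 ^ a * q <= N ->
  ville (alpha_at (2 ^ a * q) k) (star N (2 ^ a) @: setT).
Proof.
move=> odd_q q_gt1 le_k le_N; set l := 2 ^ a * q.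
have j_gt0 : 0 < 2 ^ a by rewrite expn_gt0.
have lt_jl : 2 ^ a < l by rewrite /l -{1}[2 ^ a]muln1 ltn_pmul2l.
apply/ville_alpha_atP; first by rewrite le_k andbT; lia.
move=> S sS cS.
have inj : injective (star N (2 ^ a)) by apply: star_inj; lia.
pose P := star N (2 ^ a) @^-1: S.
have defS : S = star N (2 ^ a) @: P.
  apply/setP => A; apply/idP/imsetP => [AS|[p]]; last by rewrite inE => ? ->.
  by have /imsetP[p _ defA] := subsetP sS A AS; exists p; rewrite // inE -defA.
have cP : #|P| = l by rewrite -cS defS card_imset.
rewrite defS !big_imset //=; try by move=> p p' _ _ /inj.
rewrite card_bigcap_star ?cP // add0n.
have := congr1 odd (card_bigcup_star N (2 ^ a) P).
(* The two quotients differ by the odd number [q], so ['C(N, 2 ^ a)] and ['C(N - l, 2 ^ a)] have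
   opposite parities. *)
have divN : N %/ 2 ^ a = q + (N - l) %/ 2 ^ a.
  by rewrite -{1}(subnKC le_N) (mulnC (2 ^ a)) divnMDl // mulnC.
rewrite oddD cP !odd_bin_divn divN oddD odd_q.
by case: (odd _); case: (odd _).
Qed.

Theorem theorem4 (l k : nat) (hl : 2 <= l) (hlk : l <= k) :
  (exists B : nat, forall n : nat, 1 <= n -> g (alpha_at l k) n <= B) <->
  (exists m : nat, l = 2 ^ m).
Proof.
split=> [[B leB]|[m def_l]]; last first.
  exists (2 ^ m).*2.-1 => n _; rewrite def_l; apply/bigmax_leqP => F vF.
  by apply: ltnW; apply: card_ville_pow2 vF; rewrite -def_l.
have [q] := @pfactor_coprime 2 l isT (ltnW hl).
rewrite coprime2n mulnC; set a := logn 2 l => odd_q def_l.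
have [q_gt1|q_le1] := ltnP 1 q; last first.
  exists a; rewrite def_l; case: q odd_q q_le1 {def_l} => [|[|]] // _ _.
  by rewrite muln1.
have j_gt0 : 0 < 2 ^ a by rewrite expn_gt0.
have lt_jl : 2 ^ a < l by rewrite def_l -{1}[2 ^ a]muln1 ltn_pmul2l.
(* Large enough both for [ville_star], which needs [l <= N], and for the [N] distinct stars to
   exceed the bound [B]. *)
pose N := l + B.+1.
have := leB #|[set T : {set 'I_N} | #|T| == 2 ^ a]|.
rewrite {1}card_points bin_gt0 => /(_ ltac:(rewrite /N; lia)) le_g.
have vF : ville (alpha_at l k) (star N (2 ^ a) @: setT).
  by rewrite def_l; apply: ville_star; rewrite -?def_l // /N leq_addr.
have := leq_trans (leq_card_g _ _ _ _ vF) le_g.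
rewrite card_imset ?cardsT ?card_ord; last by apply: star_inj; rewrite /N; lia.
by rewrite /N; lia.
Qed.
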